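(* Let $m\ge 3$, let $P_2=[u_1,u_2]$ be the path on two vertices and let $C_m=[v_1,v_2,\dots,v_m,v_1]$ be the cycle on $m$ vertices. Then the harmonic centrality of any vertex $(u_i,v_j)$ of the Cartesian product $P_2\square C_m$ is $$\mathcal{H}_{P_2\square C_m}(u_i,v_j)=\begin{cases}\dfrac{1}{2m-1}\Big(4H_{\frac{m-1}{2}}+\dfrac{3-m}{m+1}\Big) & \text{if } m \text{ is odd},\\[2mm] \dfrac{1}{2m-1}\Big(4H_{\frac m2}+\dfrac{2}{m+2}-\dfrac{m+2}{m}\Big) & \text{if } m \text{ is even}.\end{cases}$$
   Context: All graphs are simple, undirected and finite. For a graph $G$ of order $n\ge 2$ (number of vertices) and a vertex $u$, the harmonic centrality of $u$ is $\mathcal{H}_G(u)=\frac{\mathcal{R}_G(u)}{n-1}$, where $\mathcal{R}_G(u)=\sum_{x\in V(G),\,x\ne u}\frac{1}{d(u,x)}$, $d$ is the shortest-path distance in $G$, and $\frac{1}{d(u,x)}=0$ if there is no path from $u$ to $x$. $H_n=\sum_{k=1}^n \frac1k$ is the $n$-th harmonic number. The Cartesian product $G\square H$ has vertex set $V(G)\times V(H)$, with $(u,v)$ and $(u',v')$ adjacent iff either $u=u'$ and $v,v'$ are adjacent in $H$, or $v=v'$ and $u,u'$ are adjacent in $G$. *)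

(* Defs.v *)
From HB Require Import structures.
From mathcomp Require Import all_boot all_order all_algebra.

Set Implicit Arguments.
Unset Strict Implicit.
Unset Printing Implicit Defensive.

Import GRing.Theory.
Local Open Scope ring_scope.

Record sgraph := SGraph {
  vertex :> finType;
  adj : rel vertex;
  adj_sym : symmetric adj;
  adj_irrefl : irreflexive adj
}.

Definition walk (G : sgraph) (x y : G) (n : nat) : bool :=
  [exists p : n.-tuple G, path (@adj G) x p && (last x p == y)].

Lemma walk_ex (G : sgraph) (x y : G) :
  exists n, connect (@adj G) x y ==> walk x y n.
Proof.
have [/connectP[p xp yE]|_] := boolP (connect _ x y); last by exists 0.
exists (size p); apply/existsP; exists (in_tuple p).
by rewrite /= xp yE eqxx.
Qed.

(* Shortest-path distance; when y is not reachable from x the value is 0,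
   a junk value that inv_dist does not use. *)
Definition dist (G : sgraph) (x y : G) : nat := ex_minn (walk_ex x y).

Definition inv_dist (G : sgraph) (x y : G) : rat :=
  if connect (@adj G) x y then (dist x y)%:R^-1 else 0.

Definition reciprocal_sum (G : sgraph) (u : G) : rat :=
  \sum_(x : G | x != u) inv_dist u x.

(* Meaningful for graphs of order at least 2. *)
Definition harmonic_centrality (G : sgraph) (u : G) : rat :=
  reciprocal_sum u / (#|G|%:R - 1).

Definition harmonic_number (n : nat) : rat :=
  \sum_(1 <= k < n.+1) k%:R^-1.

Section PathGraph.
Variable n : nat.

Definition path_adj : rel 'I_n :=
  fun i j => (i.+1 == j :> nat) || (j.+1 == i :> nat).

Lemma path_adj_sym : symmetric path_adj.
Proof. by move=> i j; rewrite /path_adj orbC. Qed.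

Lemma path_adj_irrefl : irreflexive path_adj.
Proof. by move=> i; rewrite /path_adj orbb gtn_eqF. Qed.

Definition path_graph : sgraph := SGraph path_adj_sym path_adj_irrefl.
End PathGraph.

Section CycleGraph.
Variable n : nat.

(* The conjunct i != j only matters for n = 1, where it removes the loop;
   this is the n-cycle for n >= 3. *)
Definition cycle_adj : rel 'I_n :=
  fun i j => (i != j) && ((i.+1 %% n == j)%N || (j.+1 %% n == i)%N).

Lemma cycle_adj_sym : symmetric cycle_adj.
Proof. by move=> i j; rewrite /cycle_adj eq_sym orbC. Qed.

Lemma cycle_adj_irrefl : irreflexive cycle_adj.
Proof. by move=> i; rewrite /cycle_adj eqxx. Qed.

Definition cycle_graph : sgraph := SGraph cycle_adj_sym cycle_adj_irrefl.
End CycleGraph.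

Section CartesianProduct.
Variables G H : sgraph.

Definition cart_adj : rel (G * H) := fun p q =>
  ((p.1 == q.1) && adj p.2 q.2) || ((p.2 == q.2) && adj p.1 q.1).

Lemma cart_adj_sym : symmetric cart_adj.
Proof.
move=> p q; rewrite /cart_adj (eq_sym p.1) (eq_sym p.2).
by rewrite (adj_sym p.1) (adj_sym p.2).
Qed.

Lemma cart_adj_irrefl : irreflexive cart_adj.
Proof. by move=> p; rewrite /cart_adj !adj_irrefl !andbF. Qed.

Definition cart_prod : sgraph := SGraph cart_adj_sym cart_adj_irrefl.
End CartesianProduct.

(* Main.v *)
(** The distance from a fixed vertex is the only function that vanishes exactly
there, changes by at most 1 along edges, and decreases along some edge at every
other vertex. This property is additive under Cartesian products, so the
distances from [(u_i, v_j)] are [k] and [k + 1] for each cycle distance [k] from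
[v_j]. On [C_m] every [k] with [0 < k < m / 2] is attained twice, and [m / 2]
once when [m] is even; the sum of [1/k + 1/(k + 1)] then reduces to harmonic
numbers. *)
Require Import Defs.
From HB Require Import structures.
From mathcomp Require Import all_boot all_order all_algebra.
From mathcomp Require Import zify ring lra.

Set Implicit Arguments.
Unset Strict Implicit.
Unset Printing Implicit Defensive.

Import GRing.Theory.
Local Open Scope ring_scope.

Definition is_distance_from (G : sgraph) (x : G) (f : G -> nat) : Prop :=
  [/\ forall y, (f y == 0%N) = (y == x),
      forall y z, adj y z -> (f z <= (f y).+1)%N
    & forall y, y != x -> exists2 z, adj z y & f y = (f z).+1].

Lemma walk_distance_from (G : sgraph) (x : G) f :
  is_distance_from x f -> forall y, walk x y (f y).
Proof.
case=> f0 _ desc y; move fy: (f y) => n; elim: n y fy => [|n IHn] y fy.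
  by apply/existsP; exists [tuple]; rewrite /= eq_sym -f0 fy.
have /desc[z zy] : y != x by rewrite -f0 fy.
rewrite fy => -[fz].
have /existsP[p /andP[xp /eqP zE]] := IHn z (esym fz).
apply/existsP; exists [tuple of rcons p y].
by rewrite /= rcons_path last_rcons xp zE zy eqxx.
Qed.

Lemma distance_from_path (G : sgraph) (x : G) f (p : seq G) y :
  is_distance_from x f -> path (@adj G) y p ->
  (f (last y p) <= f y + size p)%N.
Proof.
case=> _ lip _; elim: p y => [|z p IHp] y /=; first by rewrite addn0.
by case/andP=> /lip yz /IHp; lia.
Qed.

(** Descending along [f] gives a walk of length [f y], so [y] is reachable and the zero branch of
    [inv_dist] is excluded; the bound along edges rules out shorter walks. *)
Lemma inv_dist_distance_from (G : sgraph) (x : G) f y :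
  is_distance_from x f -> inv_dist x y = (f y)%:R^-1.
Proof.
move=> fP; have fy := walk_distance_from fP y.
have xy : connect (@adj G) x y.
  have /existsP[p /andP[xp /eqP yE]] := fy.
  by apply/connectP; exists p.
rewrite /inv_dist xy /dist; case: ex_minnP => n.
rewrite xy /= => /existsP[p /andP[xp /eqP yE]] min_n.
have le_n := min_n _ fy.
have := distance_from_path fP xp; rewrite yE size_tuple.
have [/(_ x) + _ _] := fP; rewrite eqxx => /eqP ->.
by rewrite add0n => le_f; congr (_%:R^-1); lia.
Qed.

Lemma reciprocal_sum_distance_from (G : sgraph) (x : G) f :
  is_distance_from x f -> reciprocal_sum x = \sum_(y : G) (f y)%:R^-1.
Proof.
move=> fP; have [f0 _ _] := fP.
(* The term at [x] is [0^-1 = 0]. *)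
have fx : f x = 0%N by apply/eqP; rewrite f0.
rewrite [RHS](bigD1 x) //= fx invr0 add0r.
by apply: eq_bigr => y _; exact: inv_dist_distance_from.
Qed.

(** An edge of the product moves one coordinate only. Descent uses the first coordinate until it
    reaches [x], then the second. *)
Lemma is_distance_from_cart (G H : sgraph) (x : G) (y : H) f g :
  is_distance_from x f -> is_distance_from y g ->
  @is_distance_from (cart_prod G H) (x, y) (fun p => f p.1 + g p.2)%N.
Proof.
move=> [f0 lipf descf] [g0 lipg descg]; split.
- by case=> a b /=; rewrite addn_eq0 f0 g0.
- case=> a b [c d] /orP[] /andP[/eqP /= -> e].
  + by have := lipg _ _ e; lia.
  + by have := lipf _ _ e; lia.
- case=> a b; have [-> | ax _] := eqVneq a x.
  + rewrite xpair_eqE eqxx /= => /descg[d db gb].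
    exists (x, d); last by rewrite /= gb addnS.
    by rewrite /= /cart_adj /= eqxx db.
  + have [c ca fa] := descf a ax.
    exists (c, b); last by rewrite /= fa addSn.
    by rewrite /= /cart_adj /= eqxx ca orbT.
Qed.

Lemma is_distance_from_path2 (i : path_graph 2) :
  is_distance_from i (fun a => nat_of_bool (a != i)).
Proof.
split=> [y|y z _|y yi]; first by case: (y == i).
  by case: (z != i).
exists i; last by rewrite yi eqxx.
move: yi; rewrite -val_eqE /= /path_adj.
by have := ltn_ord i; have := ltn_ord y; lia.
Qed.

(** Subtraction is truncated, so [(b - j) + (j - b)] is the absolute difference; the minimum picks
    the shorter of the two arcs. *)
Definition cycle_dist (m j b : nat) : nat :=
  minn ((b - j) + (j - b)) (m - ((b - j) + (j - b))).

Lemma cycle_adjE m (a b : 'I_m) : (1 < m)%N ->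
  cycle_adj a b = [|| a.+1 == b, b.+1 == a, (a == 0%N :> nat) && (b.+1 == m)
                    | (b == 0%N :> nat) && (a.+1 == m)].
Proof.
move=> m1; rewrite /cycle_adj -val_eqE /=.
have E (c : 'I_m) : (c.+1 %% m = if c.+1 == m then 0 else c.+1)%N.
  case: eqP => [->|cm]; first by rewrite modnn.
  by rewrite modn_small //; have := ltn_ord c; lia.
by rewrite !E; have := ltn_ord a; have := ltn_ord b; do 2!case: ifP; lia.
Qed.

Lemma is_distance_from_cycle m (j : cycle_graph m) : (1 < m)%N ->
  is_distance_from j (fun b : cycle_graph m => cycle_dist m j b).
Proof.
move=> m1; have jm := ltn_ord j; split.
- move=> b; have bm := ltn_ord b.
  by rewrite -val_eqE /= /cycle_dist; lia.
- move=> b c; have bm := ltn_ord b; have cm := ltn_ord c.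
  by rewrite /= cycle_adjE // /cycle_dist; lia.
- move=> b; have bm := ltn_ord b; rewrite -val_eqE /= => bj.
  (* [up] and [dn] are the two neighbours of [b]; one of them lies on a shortest arc to [j]. *)
  pose up := (if b.+1 == m then 0 else b.+1)%N.
  pose dn := (if b == 0%N :> nat then m.-1 else b.-1)%N.
  have upm : (up < m)%N by rewrite /up; case: ifP; lia.
  have dnm : (dn < m)%N by rewrite /dn; case: ifP; lia.
  have [e|e] : cycle_dist m j b = (cycle_dist m j up).+1 \/
               cycle_dist m j b = (cycle_dist m j dn).+1.
  + by rewrite /cycle_dist /up /dn; do 2!case: ifP; lia.
  + exists (Ordinal upm) => //.
    by rewrite /= cycle_adjE //= /up; case: ifP; lia.
  + exists (Ordinal dnm) => //.
    by rewrite /= cycle_adjE //= /dn; case: ifP; lia.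
Qed.

(** The rotation taking [j] to 0 permutes the vertices and turns the distance into
    [minn d (m - d)]. *)
Lemma sum_cycle_dist (V : nmodType) m (j : 'I_m) (F : nat -> V) :
  \sum_(b < m) F (cycle_dist m j b) = \sum_(0 <= d < m) F (minn d (m - d)).
Proof.
have jm := ltn_ord j.
have rotP (b : 'I_m) : ((if j <= b then b - j else b + m - j) < m)%N.
  by have := ltn_ord b; case: ifP; lia.
pose rot b := Ordinal (rotP b).
have rot_inj : injective rot.
  move=> b c /(congr1 val) /= e; apply: val_inj => /=.
  by have := ltn_ord b; have := ltn_ord c; move: e; do 2!case: ifP; lia.
rewrite big_mkord [RHS](reindex_inj rot_inj); apply: eq_bigr => b _ /=.
congr F; rewrite /cycle_dist.
by have := ltn_ord b; case: ifP; lia.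
Qed.

(** The bounds on [a] make the minimum [d] up to [a] and [m - d] beyond it. *)
Lemma sum_minn_subn (V : nmodType) a m (F : nat -> V) :
  (a < m)%N -> (a.*2 <= m <= a.+1.*2)%N ->
  \sum_(0 <= d < m) F (minn d (m - d)) =
  F 0%N + (\sum_(1 <= k < a.+1) F k + \sum_(1 <= k < m - a) F k).
Proof.
move=> am a2; rewrite big_ltn ?min0n; last by lia.
rewrite (@big_cat_nat _ _ _ a.+1) //=; congr (_ + (_ + _)).
  by apply: eq_big_nat => k kr; congr F; lia.
(* Reversal followed by a shift by [a] amounts to the substitution [k = m - d]. *)
rewrite big_nat_rev /= -{1}[a.+1]add1n big_addn.
by apply: eq_big_nat => k kr; congr F; lia.
Qed.

Lemma harmonic_numberS n :
  harmonic_number n.+1 = harmonic_number n + n.+1%:R^-1.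
Proof. by rewrite /harmonic_number big_nat_recr. Qed.

Lemma sum_consecutive_inv n :
  \sum_(1 <= k < n.+1) (k%:R^-1 + k.+1%:R^-1) =
  harmonic_number n *+ 2 + n.+1%:R^-1 - 1.
Proof.
elim: n => [|n IHn]; first by rewrite /harmonic_number !big_nil.
by rewrite big_nat_recr //= IHn harmonic_numberS; ring.
Qed.

Lemma reciprocal_sum_prism m (i : path_graph 2) (j : cycle_graph m) :
  (1 < m)%N ->
  @reciprocal_sum (cart_prod (path_graph 2) (cycle_graph m)) (i, j) =
  \sum_(0 <= d < m) ((minn d (m - d))%:R^-1 + (minn d (m - d)).+1%:R^-1).
Proof.
move=> m1.
have fP := is_distance_from_cart (is_distance_from_path2 i)
             (is_distance_from_cycle j m1).
rewrite (reciprocal_sum_distance_from fP).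
rewrite -(sum_cycle_dist j (fun k => k%:R^-1 + k.+1%:R^-1)) big_split /=.
rewrite -(pair_bigA _ (fun (a : path_graph 2) (b : cycle_graph m) =>
  ((a != i) + cycle_dist m j b)%N%:R^-1)) /=.
rewrite (bigD1 i) //= eqxx; congr (_ + _).
(* The copy of the cycle over [i] gave the terms [1/k]; [rev_ord i] is the other vertex of [P_2],
   whose copy is one step further away. *)
rewrite (big_pred1 (rev_ord i)).
  apply: eq_bigr => b _; congr (_%:R^-1).
  by rewrite -val_eqE /=; have := ltn_ord i; lia.
move=> a; rewrite -val_eqE -[RHS]val_eqE /=.
by have := ltn_ord i; have := ltn_ord a; lia.
Qed.

Theorem theorem3p2 (m : nat) (hm : (3 <= m)%N)
    (i : path_graph 2) (j : cycle_graph m) :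
  harmonic_centrality ((i, j) : cart_prod (path_graph 2) (cycle_graph m)) =
    if odd m then
      1 / (2 * m%:R - 1) *
        (4 * harmonic_number (m.-1)./2 + (3 - m%:R) / (m%:R + 1))
    else
      1 / (2 * m%:R - 1) *
        (4 * harmonic_number m./2 + 2 / (m%:R + 2) - (m%:R + 2) / m%:R).
Proof.
rewrite /harmonic_centrality reciprocal_sum_prism; last by lia.
rewrite card_prod !card_ord natrM mulrC div1r.
case: ifP => m_odd; congr (_ * _).
(* With [m = 2r + 1], both sums run over [1..r]; the term [d = 0] contributes [0^-1 + 1 = 1]. *)
- have mE : m = m.-1./2.*2.+1 by lia.
  have /andP[lt_m bnd_m] :
    (m.-1./2 < m)%N && (m.-1./2.*2 <= m <= m.-1./2.+1.*2)%N.
    by lia.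
  have /= -> := sum_minn_subn (fun k => k%:R^-1 + k.+1%:R^-1 : rat) lt_m bnd_m.
  rewrite (_ : m - m.-1./2 = m.-1./2.+1)%N; last by lia.
  move: m.-1./2 mE => r ->; rewrite !sum_consecutive_inv invr0.
  (* The denominators left by [field] are nonzero because [r >= 0]. *)
  rewrite -mul2n; field.
  have := Num.Theory.ler0n rat r; lra.
(* With [m = 2r + 2], the sums run over [1..r+1] and [1..r]: the antipodal distance [r + 1] is
   counted once. *)
- have mE : m = m./2.-1.+1.*2 by lia.
  have /andP[lt_m bnd_m] :
    (m./2 < m)%N && (m./2.*2 <= m <= m./2.+1.*2)%N.
    by lia.
  have /= -> := sum_minn_subn (fun k => k%:R^-1 + k.+1%:R^-1 : rat) lt_m bnd_m.
  rewrite (_ : m - m./2 = m./2.-1.+1)%N; last by lia.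
  rewrite (_ : m./2 = m./2.-1.+1)%N; last by lia.
  rewrite /=; move: m./2.-1 mE => r ->.
  rewrite !sum_consecutive_inv invr0 harmonic_numberS.
  rewrite -mul2n; field.
  have := Num.Theory.ler0n rat r; lra.
Qed.
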